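(* Let $H$ be a complex Hilbert space and let $X, Y, Z, W \in B(H)$. Put $S=|Y|^2+|Z^{*}|^2$ and $c(ZY)=\inf_{\theta \in \mathbb{R}}\ \inf_{x\in H,\ \|x\|=1}\|\mathrm{Re}(e^{i\theta}ZY)x\|$. Then \[ w\begin{pmatrix} X & Y \\ Z & W \end{pmatrix}\leq \max\{ w(X), w(W)\} + \left[\frac{1}{16}\|S\|^2+\frac{1}{4}w^2(ZY)+\frac{1}{8}w(ZYS+SZY)\right]^{\frac{1}{4}} \] and \[ w\begin{pmatrix} X & Y \\ Z & W \end{pmatrix}\geq \max\left\{ w(X),\ w(W),\ \left[\frac{1}{16}\|S\|^2+\frac{1}{4}c^2(ZY)+\frac{1}{8}m(ZYS+SZY)\right]^{\frac{1}{4}}\right\}. \]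
   Context: $B(H)$ denotes the set of all bounded linear operators on the complex Hilbert space $H$. For $T\in B(H)$: $\|T\|$ is the operator norm; $|T|^2=T^{*}T$ (so $|Y|^2=Y^*Y$ and $|Z^*|^2=ZZ^*$); $\mathrm{Re}(T)=\frac12(T+T^* )$; the numerical radius is $w(T)=\sup\{|\langle Tx,x\rangle| : x\in H,\ \|x\|=1\}$; the Crawford number is $m(T)=\inf\{|\langle Tx,x\rangle| : x\in H,\ \|x\|=1\}$. Powers such as $w^2(T)$, $c^2(T)$ mean $(w(T))^2$, $(c(T))^2$. The operator matrix $\begin{pmatrix} X & Y \\ Z & W\end{pmatrix}$ acts on the Hilbert space direct sum $H\oplus H$ by $(x_1,x_2)\mapsto (Xx_1+Yx_2,\ Zx_1+Wx_2)$, and its numerical radius is taken on $H\oplus H$. *)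

(* Defs.v *)
From HB Require Import structures.
From mathcomp Require Import all_boot all_order all_algebra.
From mathcomp Require Import complex.
From mathcomp Require Import all_classical all_reals all_analysis.

Set Implicit Arguments.
Unset Strict Implicit.
Unset Printing Implicit Defensive.

Import Order.TTheory GRing.Theory Num.Theory.
Import numFieldNormedType.Exports.

Local Open Scope classical_set_scope.
Local Open Scope ring_scope.
Local Open Scope complex_scope.

(* The inner product is linear in its first argument and conjugate-linear in
   its second one. *)
HB.mixin Record CompleteNormedModule_isHilbert (R : realType) H
    & CompleteNormedModule R[i] H := {
  hdot : {dot H for Num.conj} ;
  hdot_norm : forall x : H, (hdot : H -> H -> R[i]) x x = `|x| ^+ 2
}.

#[short(type="hilbertType")]
HB.structure Definition Hilbert (R : realType) :=
  {H of CompleteNormedModule_isHilbert R H & CompleteNormedModule R[i] H}.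

(* An alias of the product type: the canonical norm on H * K is the sup norm,
   whereas the Hilbert direct sum carries the l^2 norm. *)
Definition hsum (R : realType) (H K : hilbertType R) : Type := (H * K)%type.

Section HilbertSum.
Variables (R : realType) (H K : hilbertType R).

HB.instance Definition _ := GRing.Lmodule.copy (hsum H K) (H * K)%type.

Definition hsum_norm (x : hsum H K) : R[i] :=
  sqrtC (`|x.1| ^+ 2 + `|x.2| ^+ 2).

Lemma sqrtC_rect (a b : R[i]) : 0 <= a -> 0 <= b ->
  sqrtC (a ^+ 2 + b ^+ 2) = `|a + 'i%R * b|.
Proof.
move=> a0 b0; rewrite -normC2_rect ?ger0_real// sqrCK//.
Qed.

Lemma hsum_norm_le (a b c d : R[i]) : 0 <= a -> 0 <= b ->
  a <= c -> b <= d -> sqrtC (a ^+ 2 + b ^+ 2) <= sqrtC (c ^+ 2 + d ^+ 2).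
Proof.
move=> a0 b0 ac bd.
have c0 := le_trans a0 ac; have d0 := le_trans b0 bd.
rewrite ler_sqrtC ?qualifE/= ?addr_ge0 ?exprn_ge0//.
by rewrite lerD// lerXn2r ?qualifE.
Qed.

Lemma hsum_normD (x y : hsum H K) :
  hsum_norm (x + y) <= hsum_norm x + hsum_norm y.
Proof.
apply: (@le_trans _ _ (sqrtC ((`|x.1| + `|y.1|) ^+ 2
                             + (`|x.2| + `|y.2|) ^+ 2))).
  by apply: hsum_norm_le; rewrite ?ler_normD.
rewrite /hsum_norm !sqrtC_rect ?addr_ge0// mulrDr addrACA.
exact: ler_normD.
Qed.

Lemma hsum_normZ (l : R[i]) (x : hsum H K) :
  hsum_norm (l *: x) = `|l| * hsum_norm x.
Proof.
rewrite /hsum_norm !normrZ !exprMn -mulrDr.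
rewrite rootCMl ?exprn_ge0// sqrCK//.
Qed.

Lemma hsum_norm0_eq0 (x : hsum H K) : hsum_norm x = 0 -> x = 0.
Proof.
case: x => a b /eqP; rewrite sqrtC_eq0 paddr_eq0 ?exprn_ge0//.
by rewrite !sqrf_eq0 !normr_eq0 /= => /andP[/eqP-> /eqP->].
Qed.

HB.instance Definition _ := @Lmodule_isNormed.Build R[i] (hsum H K)
  hsum_norm hsum_normD hsum_normZ hsum_norm0_eq0.

Lemma hsum_normE (x : hsum H K) : `|x| = sqrtC (`|x.1| ^+ 2 + `|x.2| ^+ 2).
Proof. by []. Qed.

Lemma hsum_norm_sqr (x : hsum H K) : `|x| ^+ 2 = `|x.1| ^+ 2 + `|x.2| ^+ 2.
Proof. by rewrite hsum_normE sqrtCK. Qed.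

Lemma hsum_norm_fst (x : hsum H K) : `|x.1| <= `|x|.
Proof.
by rewrite -ler_sqr ?nnegrE// hsum_norm_sqr lerDl exprn_ge0.
Qed.

Lemma hsum_norm_snd (x : hsum H K) : `|x.2| <= `|x|.
Proof.
by rewrite -ler_sqr ?nnegrE// hsum_norm_sqr lerDr exprn_ge0.
Qed.

Lemma hsum_norm_add (x : hsum H K) : `|x| <= `|x.1| + `|x.2|.
Proof.
rewrite -ler_sqr ?nnegrE ?addr_ge0// hsum_norm_sqr sqrrD addrAC.
by rewrite lerDl mulrn_wge0 ?mulr_ge0.
Qed.

Lemma hsum_cauchy_cvg (F : set_system (hsum H K)) :
  ProperFilter F -> cauchy F -> cvg F.
Proof.
move=> FF /cauchy_ballP cF.
have c1 : cauchy ((fun x : hsum H K => x.1) @ F).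
  apply/cauchy_ballP => e e0; near_simpl.
  apply: filterS (cF e e0) => -[x y] /=; rewrite -!ball_normE /=.
  by move=> xy; apply: le_lt_trans xy; exact: (hsum_norm_fst (x - y)).
have c2 : cauchy ((fun x : hsum H K => x.2) @ F).
  apply/cauchy_ballP => e e0; near_simpl.
  apply: filterS (cF e e0) => -[x y] /=; rewrite -!ball_normE /=.
  by move=> xy; apply: le_lt_trans xy; exact: (hsum_norm_snd (x - y)).
have [a Fa] : exists a : H, (fun x : hsum H K => x.1) @ F --> a.
  by apply/cvg_ex; apply: cauchy_cvg c1.
have [b Fb] : exists b : K, (fun x : hsum H K => x.2) @ F --> b.
  by apply/cvg_ex; apply: cauchy_cvg c2.
apply/cvg_ex; exists ((a, b) : hsum H K).
apply/cvgrPdist_lt => e e0; have e20 : 0 < e / 2 by rewrite divr_gt0.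
move/cvgrPdist_lt : Fa => /(_ _ e20) Fa.
move/cvgrPdist_lt : Fb => /(_ _ e20) Fb.
move: Fa Fb; near_simpl => Fa Fb; near=> x.
rewrite (le_lt_trans (hsum_norm_add _))// (splitr e) ltrD//=.
  by near: x.
by near: x.
Unshelve. all: by end_near. Qed.

HB.instance Definition _ :=
  Uniform_isComplete.Build (hsum H K) hsum_cauchy_cvg.

Definition hsum_dot (x y : hsum H K) : R[i] :=
  hdot x.1 y.1 + hdot x.2 y.2.

Lemma hsum_dot_bilinear :
  bilinear_for ( *%R : GRing.Scale.law _ _)
    (Num.conj \; *%R : GRing.Scale.law _ _) hsum_dot.
Proof.
split=> u a x y; rewrite /hsum_dot /=.
  by rewrite !linearPl mulrDr addrACA.
by rewrite !linearPr mulrDr addrACA.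
Qed.

HB.instance Definition _ := bilinear_isBilinear.Build R[i]
  (hsum H K) (hsum H K) R[i] _ _ hsum_dot hsum_dot_bilinear.

Lemma hsum_dot_herm (x y : hsum H K) :
  hsum_dot x y = (-1) ^+ false * Num.conj (hsum_dot y x).
Proof.
by rewrite expr0 mul1r /hsum_dot rmorphD/= [in LHS]hermC [X in _ + X]hermC
           !expr0 !mul1r.
Qed.

HB.instance Definition _ := isHermitianSesquilinear.Build R[i] (hsum H K)
  false Num.conj hsum_dot hsum_dot_herm.

Lemma hsum_dot_norm (x : hsum H K) : hsum_dot x x = `|x| ^+ 2.
Proof. by rewrite hsum_norm_sqr /hsum_dot !hdot_norm. Qed.

Lemma hsum_dot_gt0 (x : hsum H K) : x != 0 -> 0 < hsum_dot x x.
Proof. by move=> x0; rewrite hsum_dot_norm exprn_gt0// normr_gt0. Qed.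

HB.instance Definition _ := isDotProduct.Build R[i] (hsum H K)
  hsum_dot hsum_dot_gt0.

HB.instance Definition _ := CompleteNormedModule_isHilbert.Build R (hsum H K)
  hsum_dot_norm.

End HilbertSum.

(* Norms of R[i]-normed spaces take values in R[i]; rnorm x is the same number
   as an element of R. *)
Definition rnorm (R : realType) (V : normedZmodType R[i]) (x : V) : R :=
  complex.Re `|x|.

Definition cis (R : realType) (t : R) : R[i] := cos t +i* sin t.

Section Operators.
Variables (R : realType) (H : hilbertType R).
Implicit Type T : H -> H.

Definition usphere : set H := [set x | rnorm x = 1].

Definition opnorm T : R := sup [set rnorm (T x) | x in [set x | rnorm x <= 1]].

(* For a bounded linear T the vector z below exists (Riesz representation) and
   is unique. *)
Definition adjoint T : H -> H :=
  fun y => get [set z | forall x, hdot (T x) y = hdot x z].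

Definition abs2 T : H -> H := adjoint T \o T.

Definition re_op T : H -> H := 2^-1 \*: (T \+ adjoint T).

(* sup and inf of the empty set are 0, which fixes the values of the following
   quantities when H is the zero space. *)
Definition numradius T : R := sup [set rnorm (hdot (T x) x) | x in usphere].

Definition crawford T : R := inf [set rnorm (hdot (T x) x) | x in usphere].

Definition cnum T : R :=
  inf (range (fun t : R =>
    inf [set rnorm (re_op (cis t \*: T) x) | x in usphere])).

Definition opmx (X Y Z W : H -> H) : hsum H H -> hsum H H :=
  fun x => (X x.1 + Y x.2, Z x.1 + W x.2).

End Operators.

(* Main.v *)
Require Import Defs.
From mathcomp Require Import all_boot all_order all_algebra.
From mathcomp Require Import complex ring lra.
From mathcomp Require Import all_classical all_reals all_analysis.

Set Implicit Arguments.
Unset Strict Implicit.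
Unset Printing Implicit Defensive.

Import Order.TTheory GRing.Theory Num.Theory.
Import numFieldNormedType.Exports.

Local Open Scope classical_set_scope.
Local Open Scope ring_scope.
Local Open Scope complex_scope.

(** Let A be the off-diagonal part of the operator matrix, the one with entries
    Y and Z.  For a phase t put T_t = e^{it} Y + e^{-it} Z^*.  The real part of
    e^{it} <A x, x> equals Re <T_t x_2, x_1>, so w(A) is half of the supremum
    of the norms of the T_t ([rdot_opmx] includes the diagonal terms).  Two
    squarings link these norms to the quantities of the theorem, with V = ZY:

      T_t^* T_t = S + 2 Re(e^{2it} V)                    ([twist_squareE]),
      |T_t^* T_t x|^2 = |Sx|^2 + 4 |Re(e^{2it} V) x|^2
                        + 2 Re(e^{2it} <(VS + SV) x, x>) ([twist_square_norm]).

    Upper bound: the three terms on the right are at most |S|^2, 4 w(V)^2 and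
    2 w(VS + SV) times |x|^2, because a self-adjoint operator is bounded in
    norm by the supremum of its quadratic form ([re_op_norm_le]).  Calling the
    total 16 L^4, the norm of T_t is at most 2L, so |<A x, x>| is at most
    2 L |x_1| |x_2|, hence at most L on unit vectors; the diagonal part
    contributes at most max(w(X), w(W)).

    Lower bound: w of the whole matrix, call it w, dominates w(X) and w(W), as
    seen on vectors supported in one summand, and it dominates w(A), as seen
    by flipping the sign of x_1 ([rdot_twist_le]).  Hence T_t and its adjoint
    have norm at most 2w and T_t^* T_t has norm at most 4 w^2.  Given a unit
    vector x, choosing t to make the last term of the expansion equal to
    2 |<(VS + SV) x, x>| yields
      |Sx|^2 + 4 c(V)^2 + 2 m(VS + SV) <= 16 w^4,
    and the supremum over x turns |Sx| into |S|.

    Everything is computed with the real inner product Re <x, y>, written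
    [rdot], phases being carried by the unit complex numbers [cis t].  The
    adjoints of Y and Z come from the Riesz representation theorem ([riesz]);
    all other adjoints are explicit expressions in these two. *)

(** * Phases of complex numbers *)

Section ComplexPhase.
Variable R : realType.
Implicit Types (s t : R) (z w : R[i]).

Lemma cisD s t : cis (s + t) = cis s * cis t.
Proof.
apply/eqP; rewrite /cis sinD cosD; simpc.
by rewrite [X in _ == _ +i* X]addrC eqxx.
Qed.

Lemma cis0 : cis 0 = 1 :> R[i].
Proof. by rewrite /cis cos0 sin0. Qed.

Lemma cisDpi t : cis (pi + t) = - cis t.
Proof. by rewrite cisD /cis cospi sinpi; simpc. Qed.

Lemma conj_cis t : Num.conj (cis t) = cis (- t).
Proof. by rewrite /cis sinN cosN. Qed.

Lemma rnormM z w : rnorm (z * w) = rnorm z * rnorm w.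
Proof.
by rewrite /rnorm normrM !normc_def -rmorphM.
Qed.

Lemma rnorm_cis t : rnorm (cis t) = 1.
Proof. by rewrite /rnorm normc_def /= cos2Dsin2 sqrtr1. Qed.

(** [acos] only reaches the upper half circle; the lower one is its mirror
    image. *)
Lemma unit_complex_cis (a b : R) : a ^+ 2 + b ^+ 2 = 1 ->
  exists t, cis t = a +i* b.
Proof.
move=> ab.
have a1 : -1 <= a <= 1 by apply/andP; split; nra.
have sa : Num.sqrt (1 - a ^+ 2) = `|b|.
  by rewrite -ab addrAC subrr add0r sqrtr_sqr.
have [b0|b0] := leP 0 b.
  by exists (acos a); rewrite /cis acosK ?in_itv//= sin_acos// sa ger0_norm.
exists (- acos a); rewrite /cis cosN sinN acosK ?in_itv//= sin_acos// sa.
by rewrite ltr0_norm// opprK.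
Qed.

Lemma normc_phase z : exists t, complex.Re (cis t * z) = rnorm z.
Proof.
case: z => a b; rewrite /rnorm normc_def /=.
set r := Num.sqrt _.
have r2 : r ^+ 2 = a ^+ 2 + b ^+ 2 by rewrite sqr_sqrtr ?addr_ge0 ?sqr_ge0.
have [r0|r0] := eqVneq r 0.
  exists 0; rewrite cos0 sin0 r0; move: r2; rewrite r0 => r2; nra.
have [|t ht] := @unit_complex_cis (a / r) (- b / r).
  rewrite !expr_div_n sqrrN -mulrDl -r2 divff//.
  by rewrite expf_neq0.
exists t; case: ht => -> ->.
apply: (mulIf r0); rewrite -expr2 r2; field; exact: r0.
Qed.

Lemma rnorm_real (a : R) : rnorm a%:C = `|a|.
Proof. by rewrite /rnorm normc_def /= expr0n /= addr0 sqrtr_sqr. Qed.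

Lemma Re_le_rnorm z : complex.Re z <= rnorm z.
Proof.
rewrite /rnorm normc_def /=; apply: le_trans (ler_norm _) _.
by rewrite -sqrtr_sqr ler_wsqrtr// lerDl sqr_ge0.
Qed.

End ComplexPhase.

(** * Norm and inner product with real values *)

Section RealNorm.
Variables (R : realType) (V : normedZmodType R[i]).
Implicit Types x y : V.

Lemma rnormE x : `|x| = (rnorm x)%:C.
Proof. by rewrite /rnorm RRe_real// ger0_real. Qed.

Lemma rnorm_ge0 x : 0 <= rnorm x.
Proof. by rewrite -ler0c -rnormE. Qed.

Lemma rnormD x y : rnorm (x + y) <= rnorm x + rnorm y.
Proof. by rewrite -lecR rmorphD /= -!rnormE ler_normD. Qed.

Lemma rnorm0 : rnorm (0 : V) = 0.
Proof. by rewrite /rnorm normr0. Qed.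

Lemma rnorm0_eq0 x : rnorm x = 0 -> x = 0.
Proof. by move=> x0; apply/normr0_eq0; rewrite rnormE x0. Qed.

End RealNorm.

Lemma rnormZ (R : realType) (V : normedModType R[i]) (c : R[i])
    (x : V) : rnorm (c *: x) = rnorm c * rnorm x.
Proof.
suff: (rnorm (c *: x))%:C = (rnorm c * rnorm x)%:C by case.
by rewrite rmorphM /= -!rnormE normrZ.
Qed.


Section RealInnerProduct.
Variables (R : realType) (H : hilbertType R).
Implicit Types x y z : H.

Definition rdot x y : R := complex.Re (hdot x y).

Lemma hdotC x y : hdot x y = Num.conj (hdot y x).
Proof. by rewrite hermC expr0 mul1r. Qed.

Lemma hdotDl x y z : hdot (x + y) z = hdot x z + hdot y z.
Proof. exact: linearDl. Qed.

Lemma hdotDr x y z : hdot z (x + y) = hdot z x + hdot z y.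
Proof. exact: linearDr. Qed.

Lemma hdotZl (a : R[i]) x y : hdot (a *: x) y = a * hdot x y.
Proof. exact: linearZl_LR. Qed.

Lemma hdotZr (a : R[i]) x y : hdot x (a *: y) = Num.conj a * hdot x y.
Proof. exact: linearZr_LR. Qed.

Lemma rdotC x y : rdot x y = rdot y x.
Proof. by rewrite /rdot hdotC; case: (hdot y x). Qed.

Lemma rdot0l x : rdot 0 x = 0.
Proof. by rewrite /rdot linear0l. Qed.

Lemma rdotDl x y z : rdot (x + y) z = rdot x z + rdot y z.
Proof. by rewrite /rdot hdotDl raddfD. Qed.

Lemma rdotDr x y z : rdot z (x + y) = rdot z x + rdot z y.
Proof. by rewrite rdotC rdotDl !(rdotC z). Qed.

Lemma rdotZl (a : R) x y : rdot (a%:C *: x) y = a * rdot x y.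
Proof.
by rewrite /rdot hdotZl; case: (hdot x y) => u v /=; rewrite mul0r subr0.
Qed.

Lemma rdotZr (a : R) x y : rdot x (a%:C *: y) = a * rdot x y.
Proof. by rewrite rdotC rdotZl rdotC. Qed.

Lemma rdotNl x y : rdot (- x) y = - rdot x y.
Proof. by rewrite -scaleN1r -(mulN1r (rdot x y)) -rdotZl rmorphN1. Qed.

Lemma rdotNr x y : rdot x (- y) = - rdot x y.
Proof. by rewrite rdotC rdotNl rdotC. Qed.

Lemma rdotxx x : rdot x x = rnorm x ^+ 2.
Proof. by rewrite /rdot hdot_norm rnormE -rmorphXn. Qed.

Definition rdotE := (rdotDl, rdotDr, rdotNl, rdotNr, rdotZl, rdotZr).

Lemma rdot_cis t x y : rdot (cis t *: x) y = rdot x (cis (- t) *: y).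
Proof.
rewrite /rdot hdotZl hdotZr conj_cis opprK//.
Qed.

Lemma sqr_rnormD x y :
  rnorm (x + y) ^+ 2 = rnorm x ^+ 2 + rnorm y ^+ 2 + 2 * rdot x y.
Proof. by rewrite -!rdotxx !rdotE (rdotC y x); ring. Qed.

Lemma rdot_le x y : rdot x y <= rnorm x * rnorm y.
Proof.
have [x0|x0] := eqVneq (rnorm x) 0.
  by rewrite x0 mul0r (rnorm0_eq0 x0) rdot0l.
have [y0|y0] := eqVneq (rnorm y) 0.
  by rewrite y0 mulr0 (rnorm0_eq0 y0) rdotC rdot0l.
have := sqr_ge0 (rnorm ((rnorm y)%:C *: x - (rnorm x)%:C *: y)).
rewrite -rdotxx !rdotE !rdotxx (rdotC y x).
have {x0} : 0 < rnorm x by rewrite lt_def x0 rnorm_ge0.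
have {y0} : 0 < rnorm y by rewrite lt_def y0 rnorm_ge0.
set a := rnorm x; set b := rnorm y; set d := rdot x y => b0 a0.
have ab0 : 0 < a * b by rewrite mulr_gt0.
move=> h; rewrite -(ler_pM2l ab0); nra.
Qed.

Lemma rdot_eq x y : (forall z, rdot z x = rdot z y) -> x = y.
Proof.
move=> xy; apply/eqP; rewrite -subr_eq0; apply/eqP/rnorm0_eq0/eqP.
by rewrite -sqrf_eq0 -rdotxx rdotDr rdotNr xy subrr.
Qed.

Lemma rdot_cis_le t x y : rdot (cis t *: x) y <= rnorm (hdot x y).
Proof.
by rewrite /rdot hdotZl /= (le_trans (Re_le_rnorm _))// rnormM rnorm_cis mul1r.
Qed.

Lemma rnorm_hdot_phase x y : exists t, rnorm (hdot x y) = rdot (cis t *: x) y.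
Proof.
have [t <-] := normc_phase (hdot x y).
by exists t; rewrite /rdot hdotZl.
Qed.

Lemma rnorm_hdot_le x y : rnorm (hdot x y) <= rnorm x * rnorm y.
Proof.
have [t ->] := rnorm_hdot_phase x y.
by rewrite (le_trans (rdot_le _ _))// rnormZ rnorm_cis mul1r.
Qed.

End RealInnerProduct.

(** * Riesz representation *)

Section Riesz.
Variables (R : realType) (H : hilbertType R).
Implicit Types x y z v : H.

Lemma normr_rdot_le x y : `|rdot x y| <= rnorm x * rnorm y.
Proof.
rewrite ler_norml rdot_le andbT lerNl -rdotNl (le_trans (rdot_le _ _))//.
by rewrite -[- x]scaleN1r rnormZ /rnorm normrN1 mul1r.
Qed.

(** Completeness in a form that involves real numbers only; the explicit rate
    1/(n+1) is the one at which the minimizing sequence of [riesz] is chosen,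
    and a single index n serves both for the rate and for the distance to the
    limit. *)
Lemma fast_cauchy_cvg (u : nat -> H) (M : R) :
  (forall m n, (m <= n)%N -> rnorm (u m - u n) <= M * m.+1%:R^-1) ->
  exists z, forall e : R, 0 < e -> exists2 n : nat,
    n.+1%:R^-1 < e & rnorm (u n - z) < e.
Proof.
move=> hu.
have small (e : R) : 0 < e -> \forall n \near \oo, M * n.+1%:R^-1 < e.
  move=> e0; have : M * n.+1%:R^-1 @[n --> \oo] --> M * 0.
    apply: cvgM; [exact: cvg_cst | exact: cvg_harmonic].
  rewrite mulr0 => /cvgrPdist_lt /(_ e e0); apply: filterS => n.
  by rewrite sub0r normrN; exact/le_lt_trans/ler_norm.
have cu : cauchy (u @ \oo).
  apply/cauchy_exP => e; rewrite ltcE /= => /andP[/eqP ei e0].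
  have [N _ /(_ N (leqnn N)) hN] := small _ e0.
  exists (u N); exists N => // n Nn.
  rewrite -ball_normE /= ltcE ei rnormE /= eqxx /=.
  exact: le_lt_trans (hu _ _ Nn) hN.
have /cvg_ex[/= z uz] : cvg (u @ \oo) by exact: cauchy_cvg cu.
exists z => e e0.
have e0c : 0 < e%:C by rewrite ltcR.
have /cvgrPdist_lt /(_ _ e0c) h1 := uz.
have h2 : \forall n \near \oo, n.+1%:R^-1 < e :> R.
  have /cvgrPdist_lt /(_ e e0) := @cvg_harmonic R; apply: filterS => n.
  by rewrite sub0r normrN ger0_norm// invr_ge0 ler0n.
have [N _ /(_ N (leqnn N)) [{}h1 {}h2]] := filterI h1 h2.
exists N => //; move: h1; rewrite -normrN opprB rnormE ltcR.
exact.
Qed.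

(** The representing vector minimizes J(x) = |x|^2 - 2 Re f(x).  By the
    parallelogram identity a minimizing sequence is Cauchy.  At a point where
    J is within d^2 of its infimum, comparing J along the line x + t v shows
    that Re <v, x> - Re f(v) is at most d |v|, so it vanishes at the limit.
    Substituting i v for v then gives the imaginary parts. *)
Lemma riesz (f : H -> R[i]) (C : R) :
  (forall a x y, f (a *: x + y) = a * f x + f y) ->
  (forall x, complex.Re (f x) <= C * rnorm x) ->
  exists z, forall x, f x = hdot x z.
Proof.
move=> lf bf; pose g x := complex.Re (f x).
have gD x y : g (x + y) = g x + g y.
  by rewrite /g -[x in f (x + _)]scale1r lf mul1r raddfD.
have f0 : f 0 = 0.
  have := lf 1 0 0; rewrite scale1r addr0 mul1r => h.
  by apply: (addrI (f 0)); rewrite -h addr0.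
have gZ (a : R) x : g (a%:C *: x) = a * g x.
  rewrite /g -[_ *: _]addr0 lf f0 addr0.
  by case: (f x) => u v /=; rewrite mul0r subr0.
pose J x := rnorm x ^+ 2 - 2 * g x.
have Jge x : - C ^+ 2 <= J x.
  have := bf x; rewrite -/(g x) /J; have := sqr_ge0 (rnorm x - C); nra.
pose j := inf (range J).
have jJ x : j <= J x.
  by apply: ge_inf; [exists (- C ^+ 2) => _ [y _ <-]; exact: Jge | exists x].
have Jj (e : R) : 0 < e -> exists x, J x < j + e.
  move=> e0; have [|_ [x _ <-] hx] := @inf_adherent _ (range J) e e0.
    by split; [exists (J 0), 0 | exists (- C ^+ 2) => _ [y _ <-]; exact: Jge].
  by exists x.
have pol x y (d : R) : J x < j + d ^+ 2 -> J y < j + d ^+ 2 ->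
    rnorm (x - y) ^+ 2 <= 4 * d ^+ 2.
  move=> hx hy; have := jJ ((2^-1 : R)%:C *: (x + y)).
  move: hx hy; rewrite /J gZ gD -!rdotxx !rdotE (rdotC y x); lra.
have near_min x (d : R) v : 0 <= d -> J x < j + d ^+ 2 ->
    `|rdot v x - g v| <= d * rnorm v.
  move=> d0 hx; have [v0|v0] := eqVneq v 0.
    by rewrite v0 rdot0l /g f0 /= subr0 normr0 mulr_ge0// rnorm_ge0.
  set b := rdot v x - g v.
  have nv : 0 < rnorm v.
    rewrite lt_def rnorm_ge0 andbT; apply: contra v0 => /eqP v0.
    by rewrite (rnorm0_eq0 v0).
  have quad t : - d ^+ 2 <= t ^+ 2 * rnorm v ^+ 2 + 2 * t * b.
    have := jJ (x + t%:C *: v); move: hx; rewrite /J gD gZ /b.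
    rewrite -!rdotxx !rdotE (rdotC x v); lra.
  (* this t minimizes the quadratic polynomial in t *)
  have := quad (- b / rnorm v ^+ 2).
  have -> : (- b / rnorm v ^+ 2) ^+ 2 * rnorm v ^+ 2
      + 2 * (- b / rnorm v ^+ 2) * b = - (b ^+ 2 / rnorm v ^+ 2).
    by field; rewrite gt_eqF.
  rewrite lerN2 ler_pdivrMr ?exprn_gt0// -exprMn.
  rewrite -ler_sqrt ?sqr_ge0// !sqrtr_sqr => h.
  by rewrite (le_trans h)// ger0_norm// mulr_ge0// ltW.
have [u hu] : {u : nat -> H & forall n, J (u n) < j + n.+1%:R^-1 ^+ 2}.
  apply: (@choice _ _ (fun n x => J x < j + n.+1%:R^-1 ^+ 2)) => n.
  by apply: Jj; rewrite exprn_gt0// invr_gt0.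
have cu m n : (m <= n)%N -> rnorm (u m - u n) <= 2 * m.+1%:R^-1.
  move=> mn; rewrite -ler_sqr ?nnegrE ?rnorm_ge0 ?mulr_ge0// exprMn -natrX.
  apply: pol => //; apply: lt_le_trans (hu n) _.
  by rewrite lerD2l lerXn2r ?nnegrE// lef_pV2 ?posrE// ler_nat ltnS.
have [z hz] := fast_cauchy_cvg cu.
have gz v : g v = rdot v z.
  apply/eqP; rewrite eq_sym -subr_eq0 -normr_le0.
  apply/ler_addgt0Pr => e e0; rewrite add0r.
  (* the error is at most 2 d |v|; adding 1 to |v| covers v = 0 *)
  have v0 := rnorm_ge0 v; pose d : R := e / (2 * (rnorm v + 1)).
  have d0 : 0 < d by rewrite divr_gt0// mulr_gt0// ltr_wpDl.
  have de : e = 2 * d * (rnorm v + 1).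
    by rewrite /d; field; rewrite gt_eqF// ltr_wpDl.
  have [n ne une] := hz d d0.
  have -> : rdot v z - g v = (rdot v (u n) - g v) - rdot v (u n - z).
    by rewrite !rdotE; ring.
  rewrite (le_trans (ler_normB _ _))//.
  have := near_min (u n) n.+1%:R^-1 v (ltW _) (hu n).
  have := normr_rdot_le v (u n - z).
  rewrite invr_gt0 ltr0Sn => h1 /(_ isT) h2.
  have k1 := ler_wpM2l v0 (ltW une); have k2 := ler_wpM2r v0 (ltW ne).
  apply: le_trans (lerD h2 h1) _; apply: le_trans (lerD k2 k1) _.
  rewrite de; lra.
exists z => x; apply/eqP; rewrite eq_complex -/(g x) gz eqxx /=.
have := gz ('i *: x); rewrite /rdot hdotZl /g -[_ *: _]addr0 lf f0 addr0.
have ReiM (w : R[i]) : complex.Re ('i * w) = - complex.Im w.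
  by case: w => p q /=; rewrite mul0r mul1r sub0r.
by rewrite /= !ReiM => /oppr_inj ->.
Qed.
End Riesz.

(** * Bounded operators and their adjoints *)

Section BoundedLinear.
Variables (R : realType) (H : hilbertType R).
Implicit Types (T U A : H -> H) (x y z : H) (M : R).

(** A predicate on plain functions, since [adjoint] and the composites built
    from it are not bundled as linear maps. *)
Definition bounded_linear T :=
  linear T /\ exists2 C : R, 0 <= C & forall x, rnorm (T x) <= C * rnorm x.

Lemma linear_add T : linear T -> forall x y, T (x + y) = T x + T y.
Proof. by move=> lT x y; rewrite -[x in LHS]scale1r lT scale1r. Qed.

Lemma linear_zero T : linear T -> T 0 = 0.
Proof.
by move=> lT; apply: (addrI (T 0)); rewrite -linear_add// !addr0.
Qed.

Lemma linear_scale T : linear T -> forall a x, T (a *: x) = a *: T x.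
Proof. by move=> lT a x; rewrite -[_ *: x]addr0 lT linear_zero// addr0. Qed.

Lemma bounded_linear_near (T : {linear H -> H}) :
  bounded_near T (nbhs (0 : H)) -> bounded_linear T.
Proof.
move=> /linear_boundedP /pinfty_ex_gt0 [r r0 hr]; split; first exact: linearP.
have rE : r = (complex.Re r)%:C by rewrite RRe_real// gtr0_real.
exists (complex.Re r) => [|x]; first by rewrite -ler0c -rE ltW.
by rewrite -lecR rmorphM /= -rE -!rnormE.
Qed.

Lemma bounded_linearD T U :
  bounded_linear T -> bounded_linear U -> bounded_linear (T \+ U).
Proof.
move=> [lT [C C0 hC]] [lU [D D0 hD]]; split.
  by move=> a x y /=; rewrite lT lU scalerDr addrACA.
exists (C + D) => [|x /=]; first exact: addr_ge0.
by rewrite (le_trans (rnormD _ _))// mulrDl lerD.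
Qed.

Lemma bounded_linear_comp T U :
  bounded_linear T -> bounded_linear U -> bounded_linear (T \o U).
Proof.
move=> [lT [C C0 hC]] [lU [D D0 hD]]; split.
  by move=> a x y /=; rewrite lU lT.
exists (C * D) => [|x /=]; first exact: mulr_ge0.
by rewrite (le_trans (hC _))// -mulrA ler_wpM2l.
Qed.

(** Optimizing over the length of z, taken parallel to y, turns a bound by a
    sum of squares into a bound by the product of the norms. *)
Lemma rnorm_le_rdot x y M : 0 <= M ->
  (forall z, 2 * rdot y z <= M * (rnorm x ^+ 2 + rnorm z ^+ 2)) ->
  rnorm y <= M * rnorm x.
Proof.
move=> M0 h; have := rnorm_ge0 x; have := rnorm_ge0 y.
set a := rnorm y; set n := rnorm x => a0 n0.
have hs s : 2 * s * a ^+ 2 <= M * (n ^+ 2 + s ^+ 2 * a ^+ 2).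
  have := h (s%:C *: y); rewrite rdotZr rdotxx -/a -/n rnormZ rnorm_real exprMn.
  by rewrite real_normK ?num_real// mulrA.
have [a00|a00] := eqVneq a 0; first by rewrite a00 mulr_ge0.
have ap : 0 < a by rewrite lt_def a00.
have [n00|n00] := eqVneq n 0.
  (* if x = 0, scaling y by 1 / (M + 1) contradicts the hypothesis *)
  have Mp : 0 < M + 1 by rewrite ltr_wpDl.
  have := hs (M + 1)^-1; rewrite n00 expr0n /= add0r.
  rewrite mulrA ler_pM2r ?exprn_gt0// => k.
  have e1 : 2 / (M + 1) * (M + 1) ^+ 2 = 2 * (M + 1) by field; rewrite gt_eqF.
  have e2 : M * (M + 1)^-1 ^+ 2 * (M + 1) ^+ 2 = M by field; rewrite gt_eqF.
  have := ler_wpM2r (sqr_ge0 (M + 1)) k; rewrite e1 e2; lra.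
have np : 0 < n by rewrite lt_def n00.
have := hs (n / a).
have -> : 2 * (n / a) * a ^+ 2 = (2 * n) * a by field.
have -> : M * (n ^+ 2 + (n / a) ^+ 2 * a ^+ 2) = (2 * n) * (M * n) by field.
by rewrite ler_pM2l// mulr_gt0.
Qed.

Definition adjoint_pair T U := forall x y, hdot (T x) y = hdot x (U y).

Lemma adjoint_pairC T U : adjoint_pair T U -> adjoint_pair U T.
Proof. by move=> h x y; rewrite hdotC -h -hdotC. Qed.

Lemma rdot_adjoint T U : adjoint_pair T U ->
  forall x y, rdot (T x) y = rdot x (U y).
Proof. by move=> h x y; rewrite /rdot h. Qed.

(** The adjoint of any map is linear because the inner product separates
    points. *)
Lemma adjoint_pair_linear T U : adjoint_pair T U -> linear U.
Proof.
move=> h a x y; apply: rdot_eq => z; rewrite /rdot -h.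
by rewrite !hdotDr !hdotZr !h.
Qed.

(** Uniqueness of the adjoint: an operator exhibited as an adjoint is the one
    selected by the choice in [adjoint]. *)
Lemma adjoint_pairE T U : adjoint_pair T U -> adjoint T = U.
Proof.
move=> h; apply/funext => y; apply: rdot_eq => z.
have hU : exists w, forall x, hdot (T x) y = hdot x w by exists (U y).
have := @getPex _ [set w | forall x, hdot (T x) y = hdot x w] hU.
rewrite -/(adjoint T y) => /= hadj.
by rewrite /rdot -hadj h.
Qed.

Lemma adjointP T : bounded_linear T -> adjoint_pair T (adjoint T).
Proof.
move=> [lT [C C0 hC]] x y.
have [z hz] : exists z, forall x, hdot (T x) y = hdot x z.
  apply: (@riesz R H (fun x => hdot (T x) y) (C * rnorm y)).
    by move=> a u v; rewrite lT hdotDl hdotZl.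
  move=> u; rewrite -/(rdot (T u) y) (le_trans (rdot_le _ _))//.
  by rewrite mulrAC ler_wpM2r// rnorm_ge0.
have := @getPex _ [set w | forall x, hdot (T x) y = hdot x w].
by rewrite -/(adjoint T y) => /= /(_ (ex_intro _ z hz)).
Qed.

(** |U y|^2 = Re <T (U y), y> is at most M |U y| |y|. *)
Lemma adjoint_pair_norm T U M : 0 <= M -> adjoint_pair T U ->
  (forall x, rnorm (T x) <= M * rnorm x) ->
  forall y, rnorm (U y) <= M * rnorm y.
Proof.
move=> M0 TU hT y; have [u0|u0] := eqVneq (rnorm (U y)) 0.
  by rewrite u0 mulr_ge0// rnorm_ge0.
have up : 0 < rnorm (U y) by rewrite lt_def u0 rnorm_ge0.
rewrite -(ler_pM2l up) -expr2 -rdotxx -(rdot_adjoint TU).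
rewrite (le_trans (rdot_le _ _))// mulrA [_ * M]mulrC.
by rewrite ler_wpM2r// rnorm_ge0.
Qed.

Lemma bounded_linear_adjoint T U :
  adjoint_pair T U -> bounded_linear T -> bounded_linear U.
Proof.
move=> TU [_ [C C0 hC]]; split; first exact: adjoint_pair_linear TU.
by exists C => //; exact: adjoint_pair_norm TU hC.
Qed.

(** * Bounds by numerical radius, norm and Crawford numbers *)

Lemma unit_scale x : x != 0 -> exists2 u, rnorm u = 1 & x = (rnorm x)%:C *: u.
Proof.
move=> x0; have n0 : rnorm x != 0.
  by apply: contra x0 => /eqP h; rewrite (rnorm0_eq0 h).
exists ((rnorm x)^-1%:C *: x).
  by rewrite rnormZ rnorm_real ger0_norm ?invr_ge0 ?rnorm_ge0// mulVf.
by rewrite scalerA -rmorphM /= divff// scale1r.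
Qed.

Lemma numradius_ge T x : bounded_linear T -> rnorm x = 1 ->
  rnorm (hdot (T x) x) <= numradius T.
Proof.
move=> [_ [C _ hC]] x1; apply: ub_le_sup; last by exists x.
exists C => _ [y /= y1 <-]; rewrite (le_trans (rnorm_hdot_le _ _))//.
by rewrite y1 mulr1 (le_trans (hC y))// y1 mulr1.
Qed.

Lemma numradius_le T M : 0 <= M ->
  (forall x, rnorm x = 1 -> rnorm (hdot (T x) x) <= M) -> numradius T <= M.
Proof.
move=> M0 hM; rewrite /numradius; set E := [set _ | _ in _].
have [->|E0] := eqVneq E set0; first by rewrite sup0.
by apply: ge_sup; [exact/set0P | move=> _ [x x1 <-]; exact: hM].
Qed.

Lemma numradius_ge0 T : 0 <= numradius T.
Proof.
rewrite /numradius; set E := [set _ | _ in _].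
have [hE|/sup_out ->//] := pselect (has_sup E).
have [[_ [x x1 _]] _] := hE.
apply: (le_trans (rnorm_ge0 (hdot (T x) x))).
by apply: ub_le_sup; [case: hE | exists x].
Qed.

Lemma rdot_numradius T t x : bounded_linear T ->
  rdot (cis t *: T x) x <= numradius T * rnorm x ^+ 2.
Proof.
move=> bT; have [->|x0] := eqVneq x 0.
  by rewrite (linear_zero bT.1) scaler0 rdot0l mulr_ge0 ?numradius_ge0 ?sqr_ge0.
have [u u1] := unit_scale x0; set r := rnorm x => ->.
rewrite (linear_scale bT.1) scalerA mulrC -scalerA rdotZl rdotZr.
rewrite mulrA -expr2 mulrC.
rewrite ler_wpM2r ?sqr_ge0//.
exact: le_trans (rdot_cis_le _ _ _) (numradius_ge bT u1).
Qed.

Lemma normr_rdot_numradius T t x : bounded_linear T ->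
  `|rdot (cis t *: T x) x| <= numradius T * rnorm x ^+ 2.
Proof.
move=> bT; rewrite ler_norml rdot_numradius// andbT lerNl -rdotNl -scaleNr.
by rewrite -cisDpi rdot_numradius.
Qed.

Lemma opnorm_ge T x : bounded_linear T -> rnorm (T x) <= opnorm T * rnorm x.
Proof.
move=> bT; have [lT [C C0 hC]] := bT.
have [->|x0] := eqVneq x 0; first by rewrite (linear_zero lT) rnorm0 mulr0.
have [u u1 ux] := unit_scale x0.
rewrite [in T x]ux (linear_scale lT) rnormZ rnorm_real.
rewrite ger0_norm ?rnorm_ge0// mulrC ler_wpM2r ?rnorm_ge0//.
apply: ub_le_sup; last by exists u => //=; rewrite u1.
exists C => _ [y /= y1 <-]; rewrite (le_trans (hC y))//.
by rewrite ler_piMr.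
Qed.

Lemma opnorm_le T M : linear T -> 0 <= M ->
  (forall x, rnorm x = 1 -> rnorm (T x) <= M) -> opnorm T <= M.
Proof.
move=> lT M0 hM; apply: ge_sup.
  by exists (rnorm (T 0)), 0 => //=; rewrite rnorm0.
move=> _ [x /= x1 <-]; have [->|x0] := eqVneq x 0.
  by rewrite linear_zero// rnorm0.
have [u u1 ux] := unit_scale x0.
rewrite ux linear_scale// rnormZ rnorm_real ger0_norm ?rnorm_ge0//.
by rewrite -(mul1r M) ler_pM ?rnorm_ge0// hM.
Qed.

Lemma opnorm_ge0 T : bounded_linear T -> 0 <= opnorm T.
Proof.
move=> [lT [C C0 hC]]; apply: (le_trans (rnorm_ge0 (T 0))).
apply: ub_le_sup; last by exists 0 => //=; rewrite rnorm0.
exists C => _ [y /= y1 <-]; rewrite (le_trans (hC y))//.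
by rewrite ler_piMr.
Qed.

(** Polarization: for self-adjoint A, 4 Re <A x, z> is the difference of the
    quadratic form of A at x + z and x - z, which the hypothesis and the
    parallelogram identity bound by 2 M (|x|^2 + |z|^2). *)
Lemma selfadjoint_norm A M : 0 <= M -> adjoint_pair A A ->
  (forall x, `|rdot (A x) x| <= M * rnorm x ^+ 2) ->
  forall x, rnorm (A x) <= M * rnorm x.
Proof.
move=> M0 AA hA x; apply: rnorm_le_rdot => // z.
have lA := adjoint_pair_linear AA.
have AN u : A (- u) = - A u by rewrite -scaleN1r linear_scale// scaleN1r.
have := hA (x + z); have := hA (x - z).
rewrite !ler_norml => /andP[h1 _] /andP[_ h2]; move: h1 h2.
rewrite -!rdotxx !linear_add// AN !rdotE.
by rewrite (rdot_adjoint AA z x) (rdotC z (A x)) (rdotC z x); lra.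
Qed.

Lemma crawford_le T x : rnorm x = 1 -> crawford T <= rnorm (hdot (T x) x).
Proof.
move=> x1; apply: ge_inf; last by exists x.
by exists 0 => _ [y _ <-]; exact: rnorm_ge0.
Qed.

Lemma inf_ge0 (E : set R) : (forall r, E r -> 0 <= r) -> 0 <= inf E.
Proof.
move=> hE; have [->|/set0P E0] := eqVneq E set0; first by rewrite inf0.
exact: lb_le_inf.
Qed.

Lemma crawford_ge0 T : 0 <= crawford T.
Proof. by apply: inf_ge0 => _ [x _ <-]; exact: rnorm_ge0. Qed.

Lemma cnum_ge0 T : 0 <= cnum T.
Proof.
apply: inf_ge0 => _ [t _ <-]; apply: inf_ge0 => _ [x _ <-]; exact: rnorm_ge0.
Qed.

Lemma cnum_le T t x : rnorm x = 1 -> cnum T <= rnorm (re_op (cis t \*: T) x).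
Proof.
move=> x1; apply: (@le_trans _ _
  (inf [set rnorm (re_op (cis t \*: T) y) | y in usphere (H:=H)])).
  apply: ge_inf; last by exists t.
  exists 0 => _ [s _ <-]; apply: inf_ge0 => _ [y _ <-]; exact: rnorm_ge0.
apply: ge_inf; last by exists x.
by exists 0 => _ [y _ <-]; exact: rnorm_ge0.
Qed.

End BoundedLinear.

(** * Rotated real parts *)

Section AdjointAlgebra.
Variables (R : realType) (H : hilbertType R).
Implicit Types (T U V : H -> H).

Lemma adjoint_pairD T T' U U' : adjoint_pair T T' -> adjoint_pair U U' ->
  adjoint_pair (T \+ U) (T' \+ U').
Proof. by move=> hT hU x y; rewrite /= hdotDl hdotDr hT hU. Qed.

Lemma adjoint_pair_cis t T T' : adjoint_pair T T' ->
  adjoint_pair (cis t \*: T) (cis (- t) \*: T').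
Proof.
by move=> hT x y; rewrite /= hdotZl hdotZr conj_cis opprK hT.
Qed.

Lemma adjoint_pair_comp T T' U U' : adjoint_pair T T' -> adjoint_pair U U' ->
  adjoint_pair (T \o U) (U' \o T').
Proof. by move=> hT hU x y; rewrite /= hT hU. Qed.

Lemma re_opE T T' t x : adjoint_pair T T' ->
  (2 : R)%:C *: re_op (cis t \*: T) x = cis t *: T x + cis (- t) *: T' x.
Proof.
move=> hT; rewrite /re_op (adjoint_pairE (adjoint_pair_cis t hT)) /=.
rewrite scalerA; set c : R[i] := _ * _; suff -> : c = 1 by rewrite scale1r.
by rewrite /c rmorph_nat mulfV// pnatr_eq0.
Qed.

Lemma re_op_norm T T' t x : adjoint_pair T T' ->
  2 * rnorm (re_op (cis t \*: T) x) = rnorm (cis t *: T x + cis (- t) *: T' x).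
Proof.
by move=> hT; rewrite -(re_opE t x hT) [in RHS]rnormZ rnorm_real ger0_norm.
Qed.

(** This bounds the norm of 2 Re(e^{it} T), a self-adjoint operator whose
    quadratic form at y is twice the real part of e^{it} <T y, y>. *)
Lemma re_op_norm_le T T' t x : adjoint_pair T T' -> bounded_linear T ->
  rnorm (cis t *: T x + cis (- t) *: T' x) <= 2 * numradius T * rnorm x.
Proof.
move=> hT bT; pose A := (cis t \*: T) \+ (cis (- t) \*: T').
have hA : adjoint_pair A A.
  move=> y z; rewrite -[A in RHS]/((cis t \*: T) \+ (cis (- t) \*: T')) /=.
  rewrite addrC (adjoint_pairD (adjoint_pair_cis t hT)
    (adjoint_pair_cis (- t) (adjoint_pairC hT)))//= opprK//.
have hq s y : rdot (cis s *: T' y) y = rdot (cis (- s) *: T y) y.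
  by rewrite rdot_cis rdotC -(rdot_adjoint hT) (linear_scale bT.1).
apply: (selfadjoint_norm _ hA) => [|y].
  by rewrite mulr_ge0// numradius_ge0.
rewrite /A /= rdotDl hq opprK -mulr2n -[_ *+ 2]mulr_natl normrM ger0_norm//.
by rewrite -mulrA ler_wpM2l// normr_rdot_numradius.
Qed.

End AdjointAlgebra.

(** * The off-diagonal part *)

Section OffDiagonal.
Variables (R : realType) (H : hilbertType R).
Variables (Y Z Ys Zs : H -> H).
Hypotheses (bY : bounded_linear Y) (bZ : bounded_linear Z).
Hypotheses (hY : adjoint_pair Y Ys) (hZ : adjoint_pair Z Zs).
Implicit Types (x y : H) (t : R).

(** Twice the upper right entry of the real part of e^{it} A, where A is the
    operator matrix with off-diagonal entries Y and Z. *)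
Definition twist t : H -> H := (cis t \*: Y) \+ (cis (- t) \*: Zs).
Definition twist_adj t : H -> H := (cis (- t) \*: Ys) \+ (cis t \*: Z).

Lemma adjoint_pair_twist t : adjoint_pair (twist t) (twist_adj t).
Proof.
have := adjoint_pairD (adjoint_pair_cis t hY)
  (adjoint_pair_cis (- t) (adjoint_pairC hZ)).
by rewrite opprK.
Qed.

Let S := abs2 Y \+ abs2 (adjoint Z).
Let ZY := Z \o Y.

Lemma sum_squaresE x : S x = Ys (Y x) + Z (Zs x).
Proof.
rewrite /S /abs2 /= (adjoint_pairE hY) (adjoint_pairE hZ).
by rewrite (adjoint_pairE (adjoint_pairC hZ)).
Qed.

Lemma bounded_linear_sum_squares : bounded_linear S.
Proof.
have -> : S = (Ys \o Y) \+ (Z \o Zs) by apply/funext => x; rewrite sum_squaresE.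
apply: bounded_linearD; apply: bounded_linear_comp => //.
  exact: bounded_linear_adjoint hY bY.
exact: bounded_linear_adjoint hZ bZ.
Qed.

Lemma sum_squares_selfadjoint : adjoint_pair S S.
Proof.
have -> : S = (Ys \o Y) \+ (Z \o Zs) by apply/funext => x; rewrite sum_squaresE.
apply: adjoint_pairD; apply: adjoint_pair_comp => //; exact: adjoint_pairC.
Qed.

Lemma twist_squareE t x : twist_adj t (twist t x) =
  S x + (cis (t + t) *: ZY x + cis (- (t + t)) *: (Ys \o Zs) x).
Proof.
have lYs := adjoint_pair_linear hY; have lZ := bZ.1.
rewrite sum_squaresE /twist_adj /twist /=.
rewrite (linear_add lYs) (linear_add lZ).
rewrite !(linear_scale lYs) !(linear_scale lZ) !scalerDr.
rewrite !scalerA -!cisD addNr subrr cis0 !scale1r opprD.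
by rewrite [X in _ + X]addrC addrACA [X in _ + X]addrC.
Qed.

(** Expansion of the square of the norm of Sx + Qx with Q = 2 Re(e^{2it} ZY):
    moving S and the two halves of Q across the inner product turns the cross
    term into the quadratic form of ZY S + S ZY. *)
Lemma twist_square_norm t x :
  rnorm (twist_adj t (twist t x)) ^+ 2 =
    rnorm (S x) ^+ 2 + 4 * rnorm (re_op (cis (t + t) \*: ZY) x) ^+ 2
    + 2 * rdot (cis (t + t) *: ((ZY \o S) \+ (S \o ZY)) x) x.
Proof.
have hV : adjoint_pair ZY (Ys \o Zs) := adjoint_pair_comp hZ hY.
have lV : linear ZY := (bounded_linear_comp bZ bY).1.
have lS := bounded_linear_sum_squares.1.
rewrite twist_squareE sqr_rnormD -(re_op_norm _ _ hV) exprMn; congr (_ + _ + _).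
  by ring.
congr (_ * _); rewrite rdotDr [in RHS]/= scalerDr [RHS]rdotDl [RHS]addrC.
congr (_ + _).
  by rewrite rdotC -(rdot_adjoint sum_squares_selfadjoint) (linear_scale lS).
by rewrite -rdot_cis -(rdot_adjoint hV) (linear_scale lV).
Qed.

(** The norm of T^*T x controls that of T x, since |T x|^2 = Re <T^*T x, x>. *)
Lemma twist_norm_le K t x : 0 <= K ->
  rnorm (twist_adj t (twist t x)) ^+ 2 <= 16 * K ^+ 4 * rnorm x ^+ 2 ->
  rnorm (twist t x) <= 2 * K * rnorm x.
Proof.
move=> K0 hP; have x0 := rnorm_ge0 x.
have P4 : rnorm (twist_adj t (twist t x)) <= 4 * K ^+ 2 * rnorm x.
  rewrite -ler_sqr ?nnegrE ?rnorm_ge0 ?mulr_ge0 ?sqr_ge0//.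
  by apply: (le_trans hP); rewrite le_eqVlt; apply/orP; left; apply/eqP; ring.
rewrite -ler_sqr ?nnegrE ?rnorm_ge0 ?mulr_ge0//.
rewrite -rdotxx (rdot_adjoint (adjoint_pair_twist t)).
rewrite (le_trans (rdot_le _ _))//.
rewrite (le_trans (ler_wpM2l x0 P4))// le_eqVlt.
by apply/orP; left; apply/eqP; ring.
Qed.

(** The form bound means that T has norm at most 2 M; then so does T^*. *)
Lemma twist_square_le M t x : 0 <= M ->
  (forall u v, rdot (twist t u) v <= M * (rnorm u ^+ 2 + rnorm v ^+ 2)) ->
  rnorm (twist_adj t (twist t x)) <= 4 * M ^+ 2 * rnorm x.
Proof.
move=> M0 h.
have hT u : rnorm (twist t u) <= 2 * M * rnorm u.
  by apply: rnorm_le_rdot => [|v]; [exact: mulr_ge0 | rewrite -mulrA ler_wpM2l].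
have M20 : 0 <= 2 * M by exact: mulr_ge0.
apply: (le_trans (adjoint_pair_norm M20 (adjoint_pair_twist t) hT _)).
apply: (le_trans (ler_wpM2l M20 (hT x))).
by rewrite le_eqVlt; apply/orP; left; apply/eqP; ring.
Qed.

End OffDiagonal.

(** * Operator matrices *)

Section HilbertSumNorm.
Variables (R : realType) (H K : hilbertType R).

Lemma hsum_rdot (x y : hsum H K) :
  rdot x y = rdot x.1 y.1 + rdot x.2 y.2.
Proof. by rewrite /rdot -raddfD. Qed.

Lemma hsum_rnorm_sqr (x : hsum H K) :
  rnorm x ^+ 2 = rnorm x.1 ^+ 2 + rnorm x.2 ^+ 2.
Proof. by rewrite -!rdotxx hsum_rdot. Qed.

Lemma hsum_rnorm_fst (x : hsum H K) : rnorm x.1 <= rnorm x.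
Proof.
by rewrite -ler_sqr ?nnegrE ?rnorm_ge0// hsum_rnorm_sqr lerDl sqr_ge0.
Qed.

Lemma hsum_rnorm_snd (x : hsum H K) : rnorm x.2 <= rnorm x.
Proof.
by rewrite -ler_sqr ?nnegrE ?rnorm_ge0// hsum_rnorm_sqr lerDr sqr_ge0.
Qed.

Lemma hsum_rnorm_le (x : hsum H K) : rnorm x <= rnorm x.1 + rnorm x.2.
Proof.
have := rnorm_ge0 x.1; have := rnorm_ge0 x.2 => n2 n1.
rewrite -ler_sqr ?nnegrE ?rnorm_ge0 ?addr_ge0// hsum_rnorm_sqr.
have := mulr_ge0 n1 n2; lra.
Qed.

End HilbertSumNorm.

Section BlockOperators.
Variables (R : realType) (H : hilbertType R).
Variables (X Y Z W : H -> H).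
Hypotheses (bX : bounded_linear X) (bY : bounded_linear Y).
Hypotheses (bZ : bounded_linear Z) (bW : bounded_linear W).

Lemma bounded_linear_opmx : bounded_linear (opmx X Y Z W).
Proof.
have [lX [a a0 ha]] := bX; have [lY [b b0 hb]] := bY.
have [lZ [c c0 hc]] := bZ; have [lW [d d0 hd]] := bW.
split.
  move=> k x y; rewrite /opmx /= lX lY lZ lW.
  by congr (_, _); rewrite /= scalerDr addrACA.
exists (a + b + (c + d)) => [|x]; first by rewrite !addr_ge0.
rewrite (le_trans (hsum_rnorm_le _))//= mulrDl lerD// mulrDl
  (le_trans (rnormD _ _))// lerD//.
- exact: le_trans (ha _) (ler_wpM2l a0 (hsum_rnorm_fst x)).
- exact: le_trans (hb _) (ler_wpM2l b0 (hsum_rnorm_snd x)).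
- exact: le_trans (hc _) (ler_wpM2l c0 (hsum_rnorm_fst x)).
- exact: le_trans (hd _) (ler_wpM2l d0 (hsum_rnorm_snd x)).
Qed.

Lemma rdot_opmx t Zs (x : hsum H H) : adjoint_pair Z Zs ->
  rdot (cis t *: opmx X Y Z W x) x =
  rdot (cis t *: X x.1) x.1 + rdot (cis t *: W x.2) x.2
  + rdot (twist Y Zs t x.2) x.1.
Proof.
move=> hZ.
have hz : rdot (cis t *: Z x.1) x.2 = rdot (cis (- t) *: Zs x.2) x.1.
  rewrite [RHS]rdot_cis opprK (rdot_adjoint (adjoint_pairC hZ)).
  by rewrite (linear_scale bZ.1) rdotC.
rewrite hsum_rdot /= !scalerDr !rdotDl.
rewrite hz; ring.
Qed.

Lemma linear_twist t : linear (twist Y (adjoint Z) t).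
Proof.
exact: adjoint_pair_linear
  (adjoint_pairC (adjoint_pair_twist (adjointP bY) (adjointP bZ) t)).
Qed.

Lemma numradius_opmx_ul : numradius X <= numradius (opmx X Y Z W).
Proof.
apply: numradius_le (numradius_ge0 _) _ => x x1.
have [t ->] := rnorm_hdot_phase (X x) x.
have := rdot_numradius t ((x, 0) : hsum H H) bounded_linear_opmx.
rewrite (rdot_opmx _ _ (adjointP bZ)) hsum_rnorm_sqr /= x1 rnorm0.
rewrite (linear_zero bW.1) scaler0 (linear_zero (linear_twist t)).
rewrite !rdot0l !addr0.
by rewrite expr1n expr0n addr0 mulr1.
Qed.

Lemma numradius_opmx_dr : numradius W <= numradius (opmx X Y Z W).
Proof.
apply: numradius_le (numradius_ge0 _) _ => x x1.
have [t ->] := rnorm_hdot_phase (W x) x.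
have := rdot_numradius t ((0, x) : hsum H H) bounded_linear_opmx.
rewrite (rdot_opmx _ _ (adjointP bZ)) hsum_rnorm_sqr /= x1 rnorm0.
rewrite (linear_zero bX.1) scaler0 rdot0l [rdot (twist _ _ _ _) _]rdotC rdot0l.
by rewrite add0r addr0 expr1n expr0n add0r mulr1.
Qed.

(** Replacing x_1 by its opposite flips the sign of the off-diagonal part of
    the quadratic form and preserves the diagonal part and the norm, so the
    form of the off-diagonal part is half of a difference of two values of the
    form of the matrix. *)
Lemma rdot_twist_le t Zs (u v : H) : adjoint_pair Z Zs ->
  rdot (twist Y Zs t u) v <=
    numradius (opmx X Y Z W) * (rnorm u ^+ 2 + rnorm v ^+ 2).
Proof.
move=> hZ; have bA := bounded_linear_opmx.
have := normr_rdot_numradius t ((v, u) : hsum H H) bA.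
have := normr_rdot_numradius t ((- v, u) : hsum H H) bA.
rewrite !(rdot_opmx _ _ hZ) !hsum_rnorm_sqr /=.
rewrite -[- v]scaleN1r (linear_scale bX.1) !scaleN1r scalerN !rdotNl !rdotNr.
rewrite -(rdotxx (- v)) !rdotNl !rdotNr rdotxx !ler_norml.
move=> /andP[h1 _] /andP[_ h2]; lra.
Qed.

End BlockOperators.

Theorem theorem2p14 (R : realType) (H : hilbertType R)
    (X Y Z W : {linear H -> H})
    (hX : bounded_near X (nbhs (0 : H))) (hY : bounded_near Y (nbhs (0 : H)))
    (hZ : bounded_near Z (nbhs (0 : H))) (hW : bounded_near W (nbhs (0 : H))) :
  let S : H -> H := abs2 Y \+ abs2 (adjoint Z) in
  let ZY : H -> H := Z \o Y in
  numradius (opmx X Y Z W) <=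
    Num.max (numradius X) (numradius W) +
    (16^-1 * opnorm S ^+ 2 + 4^-1 * numradius ZY ^+ 2
      + 8^-1 * numradius ((ZY \o S) \+ (S \o ZY))) `^ (4^-1)
  /\
  Num.max (Num.max (numradius X) (numradius W))
    ((16^-1 * opnorm S ^+ 2 + 4^-1 * cnum ZY ^+ 2
      + 8^-1 * crawford ((ZY \o S) \+ (S \o ZY))) `^ (4^-1))
    <= numradius (opmx X Y Z W).
Proof.
move=> S ZY.
have bX := bounded_linear_near hX; have bY := bounded_linear_near hY.
have bZ := bounded_linear_near hZ; have bW := bounded_linear_near hW.
have aY := adjointP bY; have aZ := adjointP bZ.
have bV : bounded_linear ZY := bounded_linear_comp bZ bY.
have bS : bounded_linear S := bounded_linear_sum_squares bY bZ aY aZ.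
have bU : bounded_linear ((ZY \o S) \+ (S \o ZY)).
  by apply: bounded_linearD; apply: bounded_linear_comp.
have aV : adjoint_pair ZY (adjoint Y \o adjoint Z) := adjoint_pair_comp aZ aY.
set U := (ZY \o S) \+ (S \o ZY).
split.
  set K := (X in X `^ _); set L := K `^ _.
  have L0 : 0 <= L by exact: powR_ge0.
  have K0 : 0 <= K.
    by rewrite !addr_ge0// mulr_ge0 ?sqr_ge0 ?numradius_ge0.
  have LK : L ^+ 4 = K by rewrite -powR_mulrn// -powRrM mulVf// powRr1.
  have hP t y : rnorm (twist_adj Z (adjoint Y) t (twist Y (adjoint Z) t y)) ^+ 2
      <= 16 * L ^+ 4 * rnorm y ^+ 2.
    rewrite (twist_square_norm bY bZ aY aZ) -/S -/ZY -/U LK.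
    have h1 : rnorm (S y) ^+ 2 <= opnorm S ^+ 2 * rnorm y ^+ 2.
      rewrite -exprMn.
      rewrite lerXn2r ?nnegrE ?rnorm_ge0 ?mulr_ge0 ?opnorm_ge0 ?rnorm_ge0//.
      exact: opnorm_ge.
    have h2 : 4 * rnorm (re_op (cis (t + t) \*: ZY) y) ^+ 2
        <= 4 * numradius ZY ^+ 2 * rnorm y ^+ 2.
      rewrite -mulrA ler_pM2l// -exprMn.
      rewrite lerXn2r ?nnegrE ?rnorm_ge0 ?mulr_ge0 ?numradius_ge0 ?rnorm_ge0//.
      rewrite -(ler_pM2l (ltr0Sn _ 1)) (re_op_norm _ _ aV) mulrA.
      exact: re_op_norm_le.
    have h3 := rdot_numradius (t + t) y bU; rewrite -/U in h3.
    rewrite /K; move: h1 h2 h3; lra.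
  apply: numradius_le => [|x x1].
    by rewrite addr_ge0// le_max numradius_ge0.
  have [t ->] := rnorm_hdot_phase (opmx X Y Z W x) x.
  rewrite (rdot_opmx _ _ _ bZ _ _ aZ).
  have := hsum_rnorm_sqr x; rewrite x1 expr1n => x12.
  have hT := twist_norm_le aY aZ L0 (hP t x.2).
  set w := Num.max _ _.
  have wX : numradius X <= w by rewrite le_max lexx.
  have wW : numradius W <= w by rewrite le_max lexx orbT.
  have h1 : rdot (cis t *: X x.1) x.1 <= w * rnorm x.1 ^+ 2.
    by rewrite (le_trans (rdot_numradius _ _ bX))// ler_wpM2r// sqr_ge0.
  have h2 : rdot (cis t *: W x.2) x.2 <= w * rnorm x.2 ^+ 2.
    by rewrite (le_trans (rdot_numradius _ _ bW))// ler_wpM2r// sqr_ge0.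
  have h3 : rdot (twist Y (adjoint Z) t x.2) x.1 <= L.
    apply: (le_trans (rdot_le _ _)).
    apply: (le_trans (ler_wpM2r (rnorm_ge0 _) hT)).
    have k := mulr_ge0 L0 (sqr_ge0 (rnorm x.1 - rnorm x.2)).
    suff: 2 * L * rnorm x.2 * rnorm x.1 <=
        L * (rnorm x.1 ^+ 2 + rnorm x.2 ^+ 2).
      by rewrite -x12 mulr1.
    move: k; lra.
  apply: lerD => //; apply: (le_trans (lerD h1 h2)).
  by rewrite -mulrDr -x12 mulr1.
rewrite !ge_max (numradius_opmx_ul bX bY bZ bW) (numradius_opmx_dr bX bY bZ bW).
set w := numradius (opmx X Y Z W); have w0 : 0 <= w by exact: numradius_ge0.
have key x : rnorm x = 1 ->
    rnorm (S x) ^+ 2 + 4 * cnum ZY ^+ 2 + 2 * crawford U <= 16 * w ^+ 4.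
  move=> x1; have [s hs] := rnorm_hdot_phase (U x) x.
  (* the form of U enters with phase 2t, so half of the optimal phase is used *)
  pose t := s / 2; have tt : t + t = s by rewrite /t -splitr.
  have hM := twist_square_le aY aZ x w0
    (fun u v => rdot_twist_le bX bY bZ bW t u v aZ).
  have hM2 : rnorm (twist_adj Z (adjoint Y) t (twist Y (adjoint Z) t x)) ^+ 2
      <= 16 * w ^+ 4.
    have -> : 16 * w ^+ 4 = (4 * w ^+ 2) ^+ 2 by ring.
    rewrite lerXn2r ?nnegrE ?rnorm_ge0 ?mulr_ge0 ?sqr_ge0//.
    by move: hM; rewrite x1 mulr1.
  rewrite (twist_square_norm bY bZ aY aZ) tt -/S -/ZY -/U -hs in hM2.
  apply: le_trans hM2; rewrite !lerD ?lexx// ler_pM2l//.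
    rewrite lerXn2r ?nnegrE ?rnorm_ge0 ?cnum_ge0//; exact: cnum_le.
  exact: crawford_le.
have -> : w = (w ^+ 4) `^ 4^-1 by rewrite -powR_mulrn// -powRrM mulfV// powRr1.
rewrite ge0_ler_powR ?nnegrE ?exprn_ge0//.
  by rewrite !addr_ge0// mulr_ge0 ?sqr_ge0 ?crawford_ge0.
(* without unit vectors H is zero and every term on the left vanishes *)
have [[u u1]|nu] := pselect (exists u : H, rnorm u = 1).
  set B := 16 * w ^+ 4 - 4 * cnum ZY ^+ 2 - 2 * crawford U.
  have SB x : rnorm x = 1 -> rnorm (S x) ^+ 2 <= B.
    by move=> /key; rewrite /B; lra.
  have B0 : 0 <= B by rewrite (le_trans _ (SB u u1))// sqr_ge0.
  have oB : opnorm S ^+ 2 <= B.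
    rewrite -(sqr_sqrtr B0) lerXn2r ?nnegrE ?opnorm_ge0 ?sqrtr_ge0//.
    apply: opnorm_le => [||x x1]; [exact: bS.1 | exact: sqrtr_ge0 |].
    by rewrite -(ger0_norm (rnorm_ge0 (S x))) -sqrtr_sqr ler_wsqrtr// SB.
  by move: oB; rewrite /B; lra.
have sphere0 : usphere (H:=H) = set0.
  by apply/seteqP; split=> // x /= x1; apply: nu; exists x.
have oS : opnorm S = 0.
  apply/eqP; rewrite eq_le opnorm_ge0// andbT.
  apply: opnorm_le => //; first exact: bS.1.
  by move=> x x1; case: nu; exists x.
have -> : crawford U = 0 by rewrite /crawford sphere0 image_set0 inf0.
have -> : cnum ZY = 0.
  apply/eqP; rewrite eq_le cnum_ge0 andbT; apply: ge_inf.
    by exists 0 => _ [t _ <-]; rewrite sphere0 image_set0 inf0.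
  by exists 0 => //; rewrite sphere0 image_set0 inf0.
rewrite oS expr0n /= !mulr0 !addr0 exprn_ge0//.
Qed.
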